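(* Let $M$ be a countable homogeneous structure and $G=\mathrm{Aut}(M)$. Suppose that $\sigma\in G$ is a shifty automorphism and that $(X,d)$ is a compact metric $G$-flow. Then for every $x_*\in X$ there is some conjugate $\sigma_*\in G$ of $\sigma$ such that both $\mathrm{cl}\{\sigma_*^n(x_* ) : n<\omega\}$ and $\mathrm{cl}\{\sigma_*^{-n}(x_* ) : n<\omega\}$ contain a subflow of $X$.
   Context: $\mathrm{Aut}(M)$ carries the topology of pointwise convergence. For tuples, $a\equiv b$ means $\mathrm{tp}(a/\emptyset)=\mathrm{tp}(b/\emptyset)$ and $a\equiv_A b$ means $\mathrm{tp}(a/A)=\mathrm{tp}(b/A)$. $M$ is homogeneous if whenever $a,b$ are finite tuples with $a\equiv b$ there is an automorphism of $M$ taking $a$ to $b$. A $G$-flow is a compact Hausdorff space $X$ with a continuous action of $G$; a compact metric $G$-flow is one whose topology is given by a metric $d$. A subflow of $X$ is a nonempty compact subspace $Y\subseteq X$ with $gY=Y$ for all $g\in G$. $\mathrm{cl}$ is topological closure in $X$. For a countable structure $M$, an automorphism $\sigma\in\mathrm{Aut}(M)$ is shifty if there is an $\mathrm{Aut}(M)$-invariant binary relation $\downarrow$ on finite subsets of $M$ (applied to finite tuples via the sets they enumerate) such that: (Monotonicity) if $A\downarrow B$, $A'\subseteq A$, $B'\subseteq B$, then $A'\downarrow B'$; (Right existence) for every finite tuple $a$ there is $a'\equiv a$ such that $a\downarrow a'$; (Right shiftiness) if $A$ is finite and $b,b'$ are finite tuples such that $b'\equiv b$ and $A\downarrow b'$,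 then there is $n<\omega$ such that $b'\equiv_A\sigma^n(b)$. *)

(* Defs.v *)
From HB Require Import structures.
From mathcomp Require Import all_boot all_order all_algebra finmap.
From mathcomp Require Import all_classical all_reals all_analysis.

Set Implicit Arguments.
Unset Strict Implicit.
Unset Printing Implicit Defensive.

Local Open Scope classical_set_scope.
Local Open Scope group_scope.

Record language := Language {
  fun_symbol : Type;
  fun_arity : fun_symbol -> nat;
  rel_symbol : Type;
  rel_arity : rel_symbol -> nat }.

Record structure (L : language) (M : Type) := Structure {
  fun_interp : forall f : fun_symbol L, ('I_(fun_arity f) -> M) -> M;
  rel_interp : forall r : rel_symbol L, ('I_(rel_arity r) -> M) -> Prop }.

(** [term L V] and [formula L V] have their free variables in the type [V];
    a quantifier binds the variable [None] of [option V].  The missing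
    connectives are classically definable. *)

Inductive term (L : language) (V : Type) : Type :=
| tvar of V
| tapp (f : fun_symbol L) of ('I_(fun_arity f) -> term L V).

Inductive formula (L : language) (V : Type) : Type :=
| ffalse
| fequal of term L V & term L V
| frelation (r : rel_symbol L) of ('I_(rel_arity r) -> term L V)
| fimp of formula L V & formula L V
| fall of formula L (option V).

Fixpoint teval L M (S : structure L M) V (e : V -> M) (t : term L V) : M :=
  match t with
  | tvar v => e v
  | tapp f ts => fun_interp S (fun i => teval S e (ts i))
  end.

Definition extend M V (e : V -> M) (x : M) (v : option V) : M :=
  if v is Some v' then e v' else x.

Fixpoint sat L M (S : structure L M) V (e : V -> M) (phi : formula L V) : Prop :=
  match phi with
  | ffalse => False
  | fequal t u => teval S e t = teval S e u
  | frelation r ts => rel_interp S (fun i => teval S e (ts i))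
  | fimp phi psi => sat S e phi -> sat S e psi
  | fall phi => forall x, sat S (extend e x) phi
  end.

(** In [tp(a/A)] the variables are the positions of [a], together with one name
    for each parameter in [A]. *)

Definition tp_env (M : countType) n (a : n.-tuple M) (A : {fset M})
    (v : 'I_n + A) : M :=
  match v with inl i => tnth a i | inr c => fsval c end.

Definition tp L (M : countType) (S : structure L M) n (a : n.-tuple M)
    (A : {fset M}) : set (formula L ('I_n + A)%type) :=
  [set phi | sat S (@tp_env M n a A) phi].
Arguments tp {L M} S {n} a A.

Definition tp_eq_over L (M : countType) (S : structure L M) n (A : {fset M})
  (a b : n.-tuple M) : Prop := tp S a A = tp S b A.

Definition tp_eq L (M : countType) (S : structure L M) n (a b : n.-tuple M) :=
  tp_eq_over S fset0 a b.

Record aut L (M : Type) (S : structure L M) := Aut {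
  aut_fun :> M -> M;
  aut_inv : M -> M;
  aut_funK : cancel aut_fun aut_inv;
  aut_invK : cancel aut_inv aut_fun;
  aut_fun_interp : forall (f : fun_symbol L) (x : 'I_(fun_arity f) -> M),
    aut_fun (fun_interp S x) = fun_interp S (aut_fun \o x);
  aut_rel_interp : forall (r : rel_symbol L) (x : 'I_(rel_arity r) -> M),
    rel_interp S (aut_fun \o x) <-> rel_interp S x }.

Section AutGroup.
Context {L : language} {M : Type} {S : structure L M}.
Implicit Types g h k : aut S.

Lemma aut_ext g h : g =1 h -> g = h.
Proof.
case: g => g g' gK g'K gf gr; case: h => h h' hK h'K hf hr /= gh.
have {gh}gh : g = h by apply/funext.
subst h.
have g'h' : g' = h' by apply/funext => x; rewrite -{1}(h'K x) gK.
subst h'.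
by rewrite (Prop_irrelevance gK hK) (Prop_irrelevance g'K h'K)
  (Prop_irrelevance gf hf) (Prop_irrelevance gr hr).
Qed.

Definition aut1 : aut S.
Proof. by exists id id. Defined.

Definition autV g : aut S.
Proof.
exists (aut_inv g) g.
- exact: aut_invK.
- exact: aut_funK.
- move=> f x; apply: (can_inj (aut_funK g)); rewrite aut_fun_interp aut_invK.
  by congr fun_interp; apply/funext => i /=; rewrite aut_invK.
- move=> r x; rewrite -(aut_rel_interp g).
  suff -> : g \o (aut_inv g \o x) = x by [].
  by apply/funext => i /=; rewrite aut_invK.
Defined.

Definition autM g h : aut S.
Proof.
exists (g \o h) (aut_inv h \o aut_inv g).
- by apply: can_comp; exact: aut_funK.
- by apply: can_comp; exact: aut_invK.
- by move=> f x /=; rewrite !aut_fun_interp.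
- by move=> r x; rewrite -[_ \o x]/(g \o (h \o x)) !aut_rel_interp.
Defined.

HB.instance Definition _ := gen_eqMixin (aut S).
HB.instance Definition _ := gen_choiceMixin (aut S).

Lemma autMA : associative autM. Proof. by move=> g h k; exact: aut_ext. Qed.
Lemma aut1M : left_id aut1 autM. Proof. by move=> g; exact: aut_ext. Qed.
Lemma autM1 : right_id aut1 autM. Proof. by move=> g; exact: aut_ext. Qed.
Lemma autVM : left_inverse aut1 autV autM.
Proof. by move=> g; apply: aut_ext => x /=; rewrite aut_funK. Qed.
Lemma autMV : right_inverse aut1 autV autM.
Proof. by move=> g; apply: aut_ext => x /=; rewrite aut_invK. Qed.

HB.instance Definition _ :=
  isGroup.Build (aut S) autMA aut1M autM1 autVM autMV.

End AutGroup.

Definition aut_ptws L (M : countType) (S : structure L M) (g : aut S) :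
  {ptws M -> discrete_topology M} := aut_fun g.

HB.instance Definition _ L (M : countType) (S : structure L M) :=
  Topological.copy (aut S) (initial_topology (@aut_ptws L M S)).

Definition homogeneous L (M : countType) (S : structure L M) : Prop :=
  forall n (a b : n.-tuple M), tp_eq S a b ->
    exists g : aut S, map_tuple g a = b.

Definition tuple_set (M : countType) n (a : n.-tuple M) : {fset M} :=
  [fset x in (a : seq M)]%fset.

Record shifty_rel L (M : countType) (S : structure L M) (sigma : aut S)
    (ind : {fset M} -> {fset M} -> Prop) : Prop := ShiftyRel {
  shifty_invariant : forall (g : aut S) (A B : {fset M}),
    ind (g @` A)%fset (g @` B)%fset <-> ind A B;
  shifty_monotone : forall A B A' B' : {fset M},
    ind A B -> (A' `<=` A)%fset -> (B' `<=` B)%fset -> ind A' B';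
  shifty_right_existence : forall n (a : n.-tuple M),
    exists2 a' : n.-tuple M, tp_eq S a' a &
      ind (tuple_set a) (tuple_set a');
  shifty_right_shiftiness :
    forall (A : {fset M}) n (b b' : n.-tuple M),
      tp_eq S b' b -> ind A (tuple_set b') ->
      exists k : nat, tp_eq_over S A b' (map_tuple (sigma ^+ k) b) }.

Definition shifty L (M : countType) (S : structure L M) (sigma : aut S) : Prop :=
  exists ind : {fset M} -> {fset M} -> Prop, shifty_rel sigma ind.

Record is_flow L (M : countType) (S : structure L M) (X : topologicalType)
    (act : aut S -> X -> X) : Prop := IsFlow {
  flow_compact : compact [set: X];
  flow_hausdorff : hausdorff_space X;
  flow_act1 : forall x, act 1 x = x;
  flow_actM : forall g h x, act (g * h) x = act g (act h x);
  flow_continuous : continuous (fun p : aut S * X => act p.1 p.2) }.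

Record subflow L (M : countType) (S : structure L M) (X : topologicalType)
    (act : aut S -> X -> X) (Y : set X) : Prop := Subflow {
  subflow_nonempty : Y !=set0;
  subflow_compact : compact Y;
  subflow_invariant : forall g, act g @` Y = Y }.

Definition contains_subflow L (M : countType) (S : structure L M)
    (X : topologicalType) (act : aut S -> X -> X) (Z : set X) : Prop :=
  exists2 Y, subflow act Y & Y `<=` Z.

(* Main.v *)
(** Let [Y] be the intersection over all finite [A], [B] of the closures of
    [{g x | B independent from g A}].  Right existence and compactness make [Y]
    nonempty, and invariance of the independence relation makes it a subflow.
    If an open set [U] meets [Y], then [{g | U contains some sigma^n g x}] is
    open, and shiftiness makes it dense in [Aut(M)].  As [X] is second
    countable, a generic [g] has [Y] inside the closure of
    [{sigma^n g x | n}], so [sigma^g] is as required.  Reversing the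
    independence relation gives the same for [sigma^-1], and one generic [g]
    serves both directions. *)

Require Import Defs.
From HB Require Import structures.
From mathcomp Require Import all_boot all_order all_algebra finmap.
From mathcomp Require Import all_classical all_reals all_analysis.
Local Open Scope classical_set_scope.
Local Open Scope group_scope.

Set Implicit Arguments.
Unset Strict Implicit.
Unset Printing Implicit Defensive.

(** * Types under renaming of variables and under automorphisms *)

Fixpoint trename L V W (f : V -> W) (t : term L V) : term L W :=
  match t with
  | tvar v => tvar L (f v)
  | tapp s ts => tapp (fun i => trename f (ts i))
  end.

Fixpoint frename L V W (f : V -> W) (phi : formula L V) : formula L W :=
  match phi with
  | ffalse => ffalse L W
  | fequal t u => fequal (trename f t) (trename f u)
  | frelation r ts => frelation (fun i => trename f (ts i))
  | fimp phi psi => fimp (frename f phi) (frename f psi)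
  | fall phi => fall (frename (omap f) phi)
  end.

Section Types.
Context (L : language).

Lemma teval_trename (M : Type) (S : structure L M) V W (f : V -> W) (e : W -> M)
  (t : term L V) : teval S e (trename f t) = teval S (e \o f) t.
Proof.
by elim: t => //= s ts IH; congr fun_interp; apply/funext => i; exact: IH.
Qed.

Lemma sat_frename (M : Type) (S : structure L M) V W (f : V -> W) (e : W -> M)
  (phi : formula L V) : sat S e (frename f phi) <-> sat S (e \o f) phi.
Proof.
elim: phi W f e => {V} [V|V t u|V r ts|V phi IH psi IH'|V phi IH] W f e //=.
- by rewrite !teval_trename.
- suff -> : (fun i => teval S e (trename f (ts i))) =
    (fun i => teval S (e \o f) (ts i)) by [].
  by apply/funext => i; rewrite teval_trename.
- by rewrite IH IH'.
- have E y : extend e y \o omap f = extend (e \o f) y.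
    by apply/funext; case.
  by split=> H y; move: (H y); rewrite IH E.
Qed.

Lemma teval_aut (M : Type) (S : structure L M) (g : aut S) V (e : V -> M)
  (t : term L V) : teval S (g \o e) t = g (teval S e t).
Proof.
elim: t => //= s ts IH; rewrite aut_fun_interp; congr fun_interp.
by apply/funext => i /=; exact: IH.
Qed.

Lemma sat_aut (M : Type) (S : structure L M) (g : aut S) V (e : V -> M)
  (phi : formula L V) : sat S (g \o e) phi <-> sat S e phi.
Proof.
elim: phi e => {V} [V|V t u|V r ts|V phi IH psi IH'|V phi IH] e //=.
- by rewrite !teval_aut; split=> [/(can_inj (aut_funK g))|->].
- rewrite -[X in _ <-> X](aut_rel_interp g).
  suff -> : (fun i => teval S (g \o e) (ts i)) =
    g \o (fun i => teval S e (ts i)) by [].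
  by apply/funext => i; rewrite teval_aut.
- by rewrite IH IH'.
- have E y : extend (g \o e) (g y) = g \o extend e y by apply/funext; case.
  split=> H y; first by rewrite -IH -E; exact: H.
  (* Surjectivity of [g] handles the quantifier: each [y] is an image under [g]. *)
  by rewrite -(aut_invK g y) E IH.
Qed.

Context (M : countType) (S : structure L M).

Lemma tp_eq_aut (g : aut S) n (a : n.-tuple M) : tp_eq S (map_tuple g a) a.
Proof.
apply/funext => phi; apply/propext; rewrite /tp /=.
suff -> : tp_env (map_tuple g a) (A:=fset0) = g \o tp_env a (A:=fset0).
  exact: sat_aut.
by apply/funext; case=> [i|c] //=; [rewrite tnth_map|case: c].
Qed.

Definition fixes (A : {fset M}) (g : aut S) := forall m, m \in A -> g m = m.

(* Naming the parameters by extra tuple entries turns types over [A] into types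
   over the empty set. *)
Lemma homogeneous_over (A : {fset M}) n (a b : n.-tuple M) :
  homogeneous S -> tp_eq_over S A a b ->
  exists2 g : aut S, fixes A g & map_tuple g a = b.
Proof.
move=> homS ab.
have fset0F : @fset0 M -> False by case=> z; rewrite in_fset0.
pose c : #|{: A}|.-tuple M := [tuple val (enum_val j) | j < #|{: A}|].
(* [r] reads the positions past [n], filled by the enumeration [c] of [A], as names of parameters,
   so [frename r] turns a formula about [t ++ c] into one about [t] over [A]. *)
pose r (v : 'I_(n + #|{: A}|) + fset0) : 'I_n + A :=
  match v with
  | inl i => match fintype.split i with inl j => inl j | inr j => inr (enum_val j) end
  | inr z => False_rect _ (fset0F z)
  end.
have env (t : n.-tuple M) :
    tp_env [tuple of t ++ c] (A := fset0) = tp_env t (A := A) \o r.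
  apply/funext; case=> [i|z]; last by case: (fset0F z).
  rewrite /=; have := splitK i; case: (fintype.split i) => j <- /=.
    by rewrite tnth_lshift.
  by rewrite tnth_rshift tnth_mktuple.
have [|g gac] := homS _ [tuple of a ++ c] [tuple of b ++ c].
  apply/funext => phi; apply/propext; rewrite /tp /= !env -!sat_frename.
  by have /(congr1 (fun T => T (frename r phi))) := ab; rewrite /tp /= => ->.
have gE i : g (tnth [tuple of a ++ c] i) = tnth [tuple of b ++ c] i.
  by rewrite -gac tnth_map.
exists g.
  move=> m mA; have := gE (rshift n (enum_rank [` mA]%fset)).
  by rewrite !tnth_rshift tnth_mktuple enum_rankK.
apply: eq_from_tnth => i; rewrite tnth_map.
by have := gE (lshift #|{: A}| i); rewrite !tnth_lshift.
Qed.

End Types.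

(** * Shift systems and generic automorphisms *)

Section Shift.
Context {L : language} {M : countType} {S : structure L M}.
Implicit Types (A B C : {fset M}) (g h k : aut S).

Lemma autME g h m : (g * h) m = g (h m). Proof. by []. Qed.

Lemma autK g m : g^-1 (g m) = m. Proof. exact: aut_funK. Qed.

Lemma autVK g m : g (g^-1 m) = m. Proof. exact: aut_invK. Qed.

Lemma imfset_autM g h A : ((g * h)%g @` A = g @` (h @` A))%fset.
Proof.
apply/fsetP => m; apply/imfsetP/imfsetP => [[z zA ->]|[_ /imfsetP[z zA ->] ->]].
  by exists (h z) => //; exact: in_imfset.
by exists z.
Qed.

Lemma imfset_aut1 A : ((1 : aut S) @` A = A)%fset.
Proof.
apply/fsetP => m; apply/imfsetP/idP => [[z zA ->] //|mA].
by exists m.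
Qed.

Lemma imfset_autVK g A : (g @` ((g^-1)%g @` A) = A)%fset.
Proof. by rewrite -imfset_autM mulgV imfset_aut1. Qed.

Lemma imfset_autK g A : ((g^-1)%g @` (g @` A) = A)%fset.
Proof. by rewrite -imfset_autM mulVg imfset_aut1. Qed.

Lemma imfset_autS g A B : (A `<=` B)%fset -> (g @` A `<=` g @` B)%fset.
Proof.
move=> AB; apply/fsubsetP => _ /imfsetP[z zA ->]; apply: in_imfset.
exact: (fsubsetP AB).
Qed.

Lemma tuple_set_map g n (a : n.-tuple M) :
  tuple_set (map_tuple g a) = (g @` tuple_set a)%fset.
Proof.
apply/fsetP => m; rewrite inE /=; apply/mapP/imfsetP => -[z za ->]; exists z => //.
  by rewrite inE.
by rewrite inE in za.
Qed.

Lemma tuple_set_in_tuple A : tuple_set (in_tuple A) = A.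
Proof. by apply/fsetP => m; rewrite inE. Qed.

(* What the theorem uses of shiftiness; [D B A g] stands for [B] independent
   from [g A].  Unlike shiftiness this is visibly symmetric under inverting
   [tau]. *)
Record shift_system (tau : aut S) (D : {fset M} -> {fset M} -> aut S -> Prop) :
    Prop := ShiftSystem {
  shift_mono : forall B A B' A' g,
    D B A g -> (B' `<=` B)%fset -> (A' `<=` A)%fset -> D B' A' g;
  shift_ex : forall B A, exists g, D B A g;
  shift_left : forall B A g h, D B A g -> D (h @` B)%fset A (h * g);
  shift_right : forall B A g h, D B A g -> D B (h @` A)%fset (g * h^-1);
  shift_capture : forall B A g, D B A g -> exists n k k',
    [/\ fixes B k, fixes A k' & tau ^+ n * k' = k * g] }.

(** Inverting [g] swaps left and right translation and the roles of [A] and [B]; the capture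
    equation [tau ^+ n * k' = k * g^-1] becomes [tau ^- n * k = k' * g]. *)
Lemma shift_systemV tau D : shift_system tau D ->
  shift_system tau^-1 (fun B A g => D A B g^-1).
Proof.
move=> sD; split.
- by move=> B A B' A' g DBA BB AA; exact: (shift_mono sD DBA).
- by move=> B A; have [g Dg] := shift_ex sD A B; exists g^-1; rewrite invgK.
- by move=> B A g h /(shift_right sD h); rewrite invgM.
- by move=> B A g h /(shift_left sD h); rewrite invgM invgK.
- move=> B A g /(shift_capture sD)[n [k [k' [kA kB E]]]].
  exists n, k', k; split => //; rewrite expVgn; apply: (mulgI (tau ^+ n)).
  by rewrite mulVKg mulgA E mulgVK.
Qed.

Lemma shifty_system (sigma : aut S) : homogeneous S -> shifty sigma ->
  exists D, shift_system sigma D.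
Proof.
move=> homS [ind [inv mono ex cap]].
exists (fun B A g => ind B (g @` A)%fset); split.
- move=> B A B' A' g BA BB AA; apply: (mono _ _ _ _ BA BB).
  exact: imfset_autS.
(* Right existence for the single set [B] united with [A] suffices: monotonicity then trims its left
   copy to [B] and its image under [g] to [g A]. *)
- move=> B A; have [a' aa'] := ex _ (in_tuple (B `|` A)%fset).
  have [|g <-] := homS _ (in_tuple (B `|` A)%fset) a'; first exact: esym.
  rewrite tuple_set_map tuple_set_in_tuple => ba; exists g.
  by apply: (mono _ _ _ _ ba); [exact: fsubsetUl|exact/imfset_autS/fsubsetUr].
- by move=> B A g h; rewrite imfset_autM inv.
- by move=> B A g h BA; rewrite imfset_autM imfset_autK.
- move=> B A g BA; pose a := in_tuple A.
  have [||n] := cap B _ a (map_tuple g a); first exact: tp_eq_aut.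
    by rewrite tuple_set_map tuple_set_in_tuple.
  move=> /(homogeneous_over homS)[k kB kga].
  (* The capture equation forces this [k']. It fixes [A] because [k * g] and [sigma ^+ n] agree on
     [A]. *)
  exists n, k, (sigma ^- n * (k * g)); split=> //; last by rewrite mulVKg.
  move=> m mA; rewrite autME.
  have /(congr1 (fun t => tnth t (Ordinal (etrans (index_mem m A) mA)))) := kga.
  rewrite !tnth_map (tnth_nth m) nth_index //.
  by rewrite -autME => ->; rewrite autK.
Qed.

(* Baire category for the closed permutation group [aut S], the basic open sets
   being the cosets of the groups [fixes A]. *)
Lemma aut_generic (I : countType) (P : I -> aut S -> Prop) :
  (forall i A h, exists k A',
     fixes A k /\ forall k', fixes A' k' -> P i (k' * (k * h))) ->
  exists g, forall i, P i g.
Proof.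
move=> dense.
(* A stage is an approximation with a finite set of frozen points. Corrections multiply on the left
   and fix this set, so freezing [m] keeps its preimage, and freezing its image keeps that image.
   Both are frozen for the element coded by the stage number, as in a back-and-forth. *)
have step (p : nat * (aut S * {fset M})) : exists q : aut S * {fset M},
    [/\ (p.2.2 `<=` q.2)%fset, fixes p.2.2 (q.1 * p.2.1^-1),
      forall m : M, choice.pickle m = p.1 -> (m \in q.2) && (q.1 m \in q.2) &
      forall i : I, choice.pickle i = p.1 ->
        forall k, fixes q.2 k -> P i (k * q.1)].
  case: p => n [h A] /=.
  have [k [A' [kA kP]]] : exists k A', fixes A k /\ forall i : I, choice.pickle i = n ->
      forall k', fixes A' k' -> P i (k' * (k * h)).
    case E : (@choice.unpickle I n) => [i|].
      have [k [A' [kA kP]]] := dense i A h; exists k, A'; split=> // j jn.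
      by move: E; rewrite -jn choice.pickleK => -[->].
    exists 1, fset0; split=> // j jn.
    by move: E; rewrite -jn choice.pickleK.
  pose X : {fset M} := if @choice.unpickle M n is Some m then [fset m; (k * h) m]%fset
    else fset0.
  exists (k * h, A `|` A' `|` X)%fset; split=> /=.
  - by rewrite -fsetUA fsubsetUl.
  - by rewrite mulgK.
  - by move=> m mn; rewrite /X -mn choice.pickleK !inE !eqxx !orbT.
  - move=> i /kP{}kP k' k'F; apply: kP => m mA'; apply: k'F.
    by rewrite !inE mA' orbT.
have [F FP] := choice step.
pose s := fix s n := if n is n'.+1 then F (n', s n') else (1, fset0).
pose h n := (s n).1; pose C n := (s n).2.
have CP n : [/\ (C n `<=` C n.+1)%fset, fixes (C n) (h n.+1 * (h n)^-1),
      forall m : M, choice.pickle m = n -> (m \in C n.+1) && (h n.+1 m \in C n.+1) &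
      forall i : I, choice.pickle i = n ->
        forall k, fixes (C n.+1) k -> P i (k * h n.+1)] by exact: (FP (n, s n)).
have CS n j : (n <= j)%N -> (C n `<=` C j)%fset /\ fixes (C n) (h j * (h n)^-1).
  elim: j => [|j IH]; first by rewrite leqn0 => /eqP ->; rewrite mulgV; split.
  rewrite leq_eqVlt => /predU1P[->|]; first by rewrite mulgV; split.
  rewrite ltnS => /IH[nj fj]; have [jj fjj _ _] := CP j.
  split; first exact: fsubset_trans jj.
  move=> m mC; rewrite -(mulgVK (h j) (h j.+1)) -mulgA autME fj //.
  by apply: fjj; exact: (fsubsetP nj).
(* From stage [N m] on, the image and the preimage of [m] no longer change. *)
pose N (m : M) := (choice.pickle m).+1.
have hN m j : (N m <= j)%N -> h j m = h (N m) m.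
  move=> mj; have [_ _ /(_ m erefl)/andP[_ mC] _] := CP (choice.pickle m).
  by rewrite -[in RHS](proj2 (CS _ _ mj) _ mC) -autME mulgVK.
have hVC n j m : (n <= j)%N -> m \in C n -> (h j)^-1 m = (h n)^-1 m.
  move=> nj mC; rewrite -[in LHS](proj2 (CS _ _ nj) _ mC) -autME.
  by rewrite mulgA mulVg mul1g.
have hVN m j : (N m <= j)%N -> (h j)^-1 m = (h (N m))^-1 m.
  by move=> mj; apply: hVC => //; have [_ _ /(_ m erefl)/andP[]] := CP (choice.pickle m).
(* The pointwise limits of [h] and of its inverses. On finitely many points they agree with one late
   [h j] and its inverse, so every automorphism axiom is inherited from [h j]. *)
pose f m := h (N m) m; pose f' m := (h (N m))^-1 m.
have fE m j : (N m <= j)%N -> f m = h j m by move=> /hN.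
have f'E m j : (N m <= j)%N -> f' m = (h j)^-1 m by move=> /hVN.
have fK : cancel f f'.
  move=> m; pose j := maxn (N m) (N (f m)).
  rewrite (f'E _ j) ?leq_maxr // (fE _ j) ?leq_maxl //.
  exact: autK.
have f'K : cancel f' f.
  move=> m; pose j := maxn (N m) (N (f' m)).
  rewrite (fE _ j) ?leq_maxr // (f'E _ j) ?leq_maxl //.
  exact: autVK.
have fX n (x : 'I_n -> M) j : (\max_i N (x i) <= j)%N -> f \o x = h j \o x.
  move=> /bigmax_leqP xj; apply/funext => i /=; apply: fE; exact: xj.
have f_fun (c : fun_symbol L) (x : 'I_(fun_arity c) -> M) :
    f (fun_interp S x) = fun_interp S (f \o x).
  pose j := maxn (\max_i N (x i)) (N (fun_interp S x)).
  by rewrite (fX _ _ j) ?leq_maxl // (fE _ j) ?leq_maxr // aut_fun_interp.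
have f_rel (r : rel_symbol L) (x : 'I_(rel_arity r) -> M) :
    rel_interp S (f \o x) <-> rel_interp S x.
  by rewrite (fX _ _ _ (leqnn _)) aut_rel_interp.
pose g : aut S := Aut fK f'K f_fun f_rel.
exists g => i; have [_ _ _ /(_ i erefl)] := CP (choice.pickle i).
move=> /(_ (g * (h (choice.pickle i).+1)^-1)); rewrite mulgVK; apply.
move=> m mC; set n := (choice.pickle i).+1; rewrite autME.
pose j := maxn n (N ((h n)^-1 m)).
rewrite -[g _]/(f _) (fE _ j) ?leq_maxr // -(hVC _ j _ _ mC) ?leq_maxl //.
exact: autVK.
Qed.

End Shift.

(** * The limit subflow and the density of returns to it *)

Section Flow.
Context {L : language} {M : countType} {S : structure L M}.

(** The filter [F] of maps fixing larger and larger finite sets converges to the identity in each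
    coordinate, hence in the pointwise topology. *)
Lemma nbhs_aut1 (N : set (aut S)) :
  nbhs (1 : aut S) N -> exists A : {fset M}, forall g, fixes A g -> N g.
Proof.
pose F : set_system {ptws M -> discrete_topology M} :=
  filter_from [set: {fset M}] (fun A => [set f | forall m, m \in A -> f m = m]).
have FF : Filter F.
  apply: filter_from_filter; first by exists fset0.
  move=> A B _ _; exists (A `|` B)%fset => // f fAB; split=> m mX; apply: fAB.
    by rewrite inE mX.
  by rewrite inE mX orbT.
have Fid : F --> (aut_ptws (1 : aut S) : {ptws M -> discrete_topology M}).
  apply/cvg_sup => m V; rewrite (@nbhsE (initial_topology (fun f : M -> discrete_topology M => f m))) => -[W [[U oU <-] Um] WV].
  apply: filterS WV _; exists [fset m]%fset => // f fm /=.
  by rewrite /preimage /= fm // inE.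
rewrite nbhsE => -[W [[U oU <-] U1] WN].
have [A _ AU] : F U by apply: Fid; apply: open_nbhs_nbhs; split.
by exists A => g gA; apply: WN; apply: AU.
Qed.

Context {X : topologicalType}.
(** For a shift system, the cluster set of the orbit map at [x] along the filter generated by the
    sets [D B A]. *)
Definition limit_set (act : aut S -> X -> X)
    (D : {fset M} -> {fset M} -> aut S -> Prop) (x : X) : set X :=
  [set y | forall B A V, nbhs y V -> exists2 g, D B A g & V (act g x)].

Context {act : aut S -> X -> X}.
Hypothesis flowX : is_flow act.

Let actM := flow_actM flowX.
Let act1 := flow_act1 flowX.

(** Joint continuity at [(1, act g u)] yields [A], and at [(g, u)] yields [V]; one pair thus absorbs
    errors in the group and in the point simultaneously. *)
Lemma act_nbhs g u (W : set X) : nbhs (act g u) W ->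
  exists A : {fset M}, exists2 V, nbhs u V &
    forall k, fixes A k -> forall v, V v -> W (act (k * g) v).
Proof.
move=> gW; have gW1 : nbhs (act 1 (act g u)) W by rewrite act1.
have [[P Q] [/= P1 Qgu] PQ] := flow_continuous flowX (x := (1, act g u)) gW1.
have [[P' V] [/= P'g Vu] PV] := flow_continuous flowX (x := (g, u)) Qgu.
have [A AP] := nbhs_aut1 P1.
exists A, V => // k /AP Pk v Vv; rewrite actM.
apply: (PQ (k, act g v)); split=> //=.
by apply: (PV (g, v)); split=> //=; exact: nbhs_singleton.
Qed.

Lemma act_continuous g : continuous (act g).
Proof.
move=> u W /act_nbhs[A [V Vu VW]]; apply: filterS Vu => v Vv.
by rewrite /preimage /= -[g]mul1g; exact: VW.
Qed.

Variables (tau : aut S) (D : {fset M} -> {fset M} -> aut S -> Prop).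
Hypothesis sD : shift_system tau D.

Lemma limit_set_act x g y : limit_set act D x y -> limit_set act D x (act g y).
Proof.
move=> Yy B A V /act_continuous gV.
have [h Dh hV] := Yy ((g^-1)%g @` B)%fset A _ gV.
exists (g * h); last by rewrite actM.
by have := shift_left sD g Dh; rewrite imfset_autVK.
Qed.

(** Monotonicity and existence make the sets [D B A] generate a proper filter, so compactness gives
    a cluster point. Invariance uses left translation by [g] and by its inverse. *)
Lemma subflow_limit_set x : subflow act (limit_set act D x).
Proof.
split.
- pose F := filter_from [set: {fset M} * {fset M}]
    (fun p => [set act g x | g in D p.1 p.2]).
  have FF : ProperFilter F.
    apply: filter_from_proper.
      apply: filter_from_filter; first by exists (fset0, fset0).
      move=> [B A] [B' A'] _ _; exists (B `|` B', A `|` A')%fset => //= y [g Dg <-].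
      split; exists g => //; apply: (shift_mono sD Dg) => /=;
        by rewrite ?fsubsetUl ?fsubsetUr.
    move=> [B A] _; have [g Dg] := shift_ex sD B A.
    by exists (act g x); exists g.
  have [y [_ Fy]] := flow_compact flowX FF filterT.
  exists y => B A V yV.
  have [|_ [[g Dg <-] Vg]] := Fy [set act g x | g in D B A] V _ yV.
    by exists (B, A).
  by exists g.
- apply: (subclosed_compact _ (flow_compact flowX)) => // y Yy B A V.
  move=> /nbhs_interior yV.
  by have [z [Yz Vz]] := Yy _ yV; exact: Yz.
- move=> g; apply/seteqP; split=> [_ [y Yy <-]|y Yy]; first exact: limit_set_act.
  exists (act g^-1 y); first exact: limit_set_act.
  by rewrite -actM mulgV act1.
Qed.

(** Density and openness in the form [aut_generic] asks for. Take [g0] with [act g0 x] near [y];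
    capturing [g0 * h^-1] gives [tau ^+ n * k' * h = k * g0], where [k] fixes [B] and so keeps
    [act g0 x] in [U]. The set [A'] is the margin from continuity. *)
Lemma limit_set_dense x y (U : set X) (A : {fset M}) h :
  limit_set act D x y -> nbhs y U -> exists k A',
    fixes A k /\ forall k', fixes A' k' -> exists n,
      U (act (tau ^+ n * (k' * (k * h))) x).
Proof.
rewrite -[y in nbhs y]act1 => Yy /nbhs_interior /act_nbhs[B [V Vy BV]].
(* [A] is pulled back by [h] because right translation by [h^-1] pushes it forward again. *)
have [g0 /(shift_right sD h) Dg0 Vg0] := Yy B ((h^-1)%g @` A)%fset V Vy.
move: Dg0; rewrite imfset_autVK => /(shift_capture sD)[n [k [k' [kB k'A E]]]].
have : nbhs (act (tau ^+ n) (act (k' * h) x)) U.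
  rewrite -actM mulgA E -mulgA mulgVK actM -[k]mulg1.
  exact: BV.
move=> /act_continuous; rewrite -[_ (k' * h) x]act1 => /act_nbhs[A' [W Wx A'W]].
exists k', A'; split=> // k'' /A'W k''W; exists n.
rewrite actM actM -[k'']mulg1; apply: k''W.
exact: nbhs_singleton.
Qed.

(** As [(tau ^ g) ^+ n] is [g^-1 * tau ^+ n * g], its orbit of [x] is the translate by [g^-1] of the
    points accumulating on [Y], and [Y] is invariant. *)
Lemma sub_closure_conj x g (Y : set X) : subflow act Y ->
  (forall y U, Y y -> nbhs y U -> exists n, U (act (tau ^+ n * g) x)) ->
  contains_subflow act (closure [set act ((tau ^ g) ^+ n) x | n in [set: nat]]).
Proof.
move=> sY gY; exists Y => // y Yy U yU.
have Ygy : Y (act g y) by rewrite -(subflow_invariant sY g); exists y.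
have [|n nU] := gY _ (act (g^-1)%g @^-1` U) Ygy.
  by apply: act_continuous; rewrite -actM mulVg act1.
exists (act ((tau ^ g) ^+ n) x); split; first by exists n.
by rewrite -conjXg conjgE actM.
Qed.

End Flow.

(** * One generic conjugator for both directions *)

Theorem theorem6p5 (L : language) (M : countType) (S : structure L M)
    (sigma : aut S) (R : realType) (X : metricType R) (act : aut S -> X -> X)
    (homM : homogeneous S) (shifty_sigma : shifty sigma) (flowX : is_flow act)
    (x : X) :
  exists sigma' : aut S,
    [/\ exists g : aut S, sigma' = sigma ^ g,
        contains_subflow act (closure [set act (sigma' ^+ n) x | n in [set: nat]])
      & contains_subflow act (closure [set act (sigma' ^- n) x | n in [set: nat]])].
Proof.
have [D sD] := shifty_system homM shifty_sigma.
(* The boolean selects the direction: [sigma] for [true], its inverse for [false]. *)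
pose E b := if b then D else fun B A g => D A B g^-1.
pose tau b := if b then sigma else sigma^-1.
have sE b : shift_system (tau b) (E b) by case: b; last exact: shift_systemV.
have [BX cBX [openB basisB]] : @second_countable X.
  pose XP : pseudoPMetricType R := HB.pack X (isPointed.Build X x).
  exact: (@compact_second_countable R XP (flow_compact flowX)).
have /countable_injP[f finj] := cBX.
(* One requirement per code of a basic open set and per direction, vacuous unless the open set meets
   the limit set of that direction. *)
have [|g gP] := @aut_generic L M S (nat * bool)%type (fun i g => forall U, BX U ->
    f U = i.1 -> limit_set act (E i.2) x `&` U !=set0 ->
    exists n, U (act (tau i.2 ^+ n * g) x)).
  move=> [i b] A h /=.
  have [[U [BU Ui [y [Yy Uy]]]]|noU] := pselect (exists U, [/\ BX U, f U = i &
    limit_set act (E b) x `&` U !=set0]); last first.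
    exists 1, fset0; split=> // k _ U BU Ui YU.
    by exfalso; apply: noU; exists U.
  have [|k [A' [kA kU]]] := limit_set_dense flowX (sE b) A h Yy (U := U).
    by apply: open_nbhs_nbhs; split => //; exact: openB.
  exists k, A'; split=> // k' /kU[n nU] V BV Vi _; exists n.
  by rewrite (finj V U) ?inE // Vi.
have gY b : contains_subflow act
    (closure [set act ((tau b ^ g) ^+ n) x | n in [set: nat]]).
  apply: (sub_closure_conj flowX (subflow_limit_set flowX (sE b) x)) => y U Yy.
  move=> /basisB[V [BV Vy] VU].
  have [|n nV] := gP (f V, b) V BV erefl; first by exists y.
  by exists n; exact: VU.
exists (sigma ^ g); split; [by exists g|exact: (gY true)|].
have := gY false; rewrite /tau conjVg; congr (contains_subflow _ (closure _)).
by apply/seteqP; split=> _ [n _ <-]; exists n; rewrite ?expVgn.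
Qed.
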